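(* Let $H$ be any one of the four Hamiltonians $H^{L},H^{ON},H^{PH},H^{BP}:\overline\Omega\times\mathbb{R}\times\mathbb{R}^2\to\mathbb{R}$ defined in the context and let $g:\partial\Omega\to\mathbb{R}$ be continuous. Then the Dirichlet problem $$H(x,u(x),\nabla u(x))=0\ \text{ for all } x\in\Omega,\qquad u(x)=g(x)\ \text{ for all } x\in\partial\Omega$$ (with the boundary condition understood pointwise) admits at most one viscosity solution $u\in C(\overline\Omega)$.
   Context: Let $\Omega\subset\mathbb{R}^2$ be a bounded open set and $f>0$ a constant. For $x\in\mathbb{R}^2$, $p\in\mathbb{R}^2$ put $$Q(x)=\frac{f}{\sqrt{f^2+|x|^2}},\qquad W(x,p)=\frac{f^2|p|^2+(p\cdot x)^2}{Q(x)^2}.$$ Constants: for the Oren-Nayar model, $\sigma\in[0,\pi/2)$, $A=1-0.5\,\sigma^2(\sigma^2+0.33)^{-1}$, $B=0.45\,\sigma^2(\sigma^2+0.09)^{-1}$; for the Phong and Blinn-Phong models, $k_A,k_D,k_S\ge 0$ with $k_A+k_D+k_S=1$ and $k_D>0$; $\alpha\ge1$ is an integer; $c\ge 1$ is a real number. Define on $[0,+\infty)$ $$F_L(r)=\sqrt{r+1},\qquad F_{ON}(r)=\frac{r+1}{A\sqrt{r+1}+Br},\qquad F_{BP}(r)=\frac{(r+1)^{c/2}}{k_D(r+1)^{\frac{c-1}{2}}+k_S},$$ $$F_{PH}(r)=\begin{cases}\dfrac{\sqrt{r+1}}{k_D}& r\ge 1,\\[2mm] \dfrac{(r+1)^{\alpha+1/2}}{k_D(r+1)^{\alpha}+k_S(r+1)^{1/2}(1-r)^{\alpha}}&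 0\le r<1.\end{cases}$$ Let $I,I_A:\overline\Omega\to\mathbb{R}$ be given functions (image intensity and ambient light component). For $M\in\{L,ON,PH,BP\}$ the Hamiltonian is $$H^{M}(x,r,p)=-e^{-2r}+\mathcal{I}(x)\,f^2\,F_M(W(x,p)),$$ where $\mathcal{I}=I$ if $M\in\{L,ON\}$ and $\mathcal{I}=I-k_AI_A$ if $M\in\{PH,BP\}$. Standing assumption: $\mathcal{I}$ is Lipschitz continuous in $\overline\Omega$, and there exist $\delta>0$ and a neighborhood $\Gamma$ of $\partial\Omega$ such that $\mathcal{I}(x)\ge\delta>0$ for $x\in\Gamma$ (i.e. for $x\in\Gamma\cap\overline\Omega$). Viscosity solutions: a viscosity subsolution of $H(x,u,\nabla u)=0$ on $\Omega$ is an upper semicontinuous $u:\Omega\to\mathbb{R}$ such that for any $\phi\in C^1(\Omega)$, if $x_0\in\Omega$ is a local maximum point of $u-\phi$, then $H(x_0,u(x_0),\nabla\phi(x_0))\le 0$. A viscosity supersolution is a lower semicontinuous $u:\Omega\to\mathbb{R}$ such that for any $\phi\in C^1(\Omega)$, if $x_0\in\Omega$ is a local minimum point of $u-\phi$, then $H(x_0,u(x_0),\nabla\phi(x_0))\ge 0$. A viscosity solution is both a subsolution and a supersolution. A viscosity solution of the Dirichlet problem is a function $u\in C(\overline\Omega)$ that is a viscosity solution of the equation on $\Omega$ and satisfies $u=g$ pointwise on $\partial\Omega$. *)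

(* Defs.v *)
(* Functions on a subset of the plane are total functions
   'rV[R]_2 -> R whose values outside the relevant set are never used.
   The library norm on 'rV[R]_2 is the sup norm: it is used only for topology,
   boundedness and Lipschitz continuity, which do not depend on the choice of
   norm; the Hamiltonians use the Euclidean norm [enorm]. *)
From mathcomp Require Import all_boot all_order all_algebra.
From mathcomp Require Import all_classical all_reals all_analysis.

Set Implicit Arguments.
Unset Strict Implicit.
Unset Printing Implicit Defensive.

Import Order.TTheory GRing.Theory Num.Theory.
Import numFieldNormedType.Exports.

Local Open Scope classical_set_scope.
Local Open Scope ring_scope.

Definition dot (R : realType) (x y : 'rV[R]_2) : R :=
  \sum_(i < 2) x ord0 i * y ord0 i.

Definition enorm (R : realType) (x : 'rV[R]_2) : R := Num.sqrt (dot x x).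

Definition boundary (T : topologicalType) (A : set T) : set T :=
  closure A `\` A°.

Definition grad (R : realType) (phi : 'rV[R]_2 -> R) (x : 'rV[R]_2) :
    'rV[R]_2 :=
  \row_(i < 2) 'D_(delta_mx ord0 i) phi x.

Section Viscosity.
Variable R : realType.
Implicit Types (Omega : set 'rV[R]_2) (H : 'rV[R]_2 -> R -> 'rV[R]_2 -> R).
Implicit Types u phi g : 'rV[R]_2 -> R.

Definition usc_on Omega u : Prop :=
  forall x, Omega x ->
  forall a, u x < a -> \forall y \near within Omega (nbhs x), u y < a.

Definition lsc_on Omega u : Prop :=
  forall x, Omega x ->
  forall a, a < u x -> \forall y \near within Omega (nbhs x), a < u y.

Definition C1_on Omega phi : Prop :=
  (forall x, Omega x -> differentiable phi x) /\
  {within Omega, continuous (grad phi)}.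

Definition local_max_on Omega (w : 'rV[R]_2 -> R) (x0 : 'rV[R]_2) : Prop :=
  \forall y \near within Omega (nbhs x0), w y <= w x0.

Definition local_min_on Omega (w : 'rV[R]_2 -> R) (x0 : 'rV[R]_2) : Prop :=
  \forall y \near within Omega (nbhs x0), w x0 <= w y.

Definition viscosity_subsolution Omega H u : Prop :=
  usc_on Omega u /\
  forall phi, C1_on Omega phi ->
  forall x0, Omega x0 -> local_max_on Omega (fun x => u x - phi x) x0 ->
  H x0 (u x0) (grad phi x0) <= 0.

Definition viscosity_supersolution Omega H u : Prop :=
  lsc_on Omega u /\
  forall phi, C1_on Omega phi ->
  forall x0, Omega x0 -> local_min_on Omega (fun x => u x - phi x) x0 ->
  0 <= H x0 (u x0) (grad phi x0).

Definition viscosity_solution Omega H u : Prop :=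
  viscosity_subsolution Omega H u /\ viscosity_supersolution Omega H u.

Definition dirichlet_viscosity_solution Omega H g u : Prop :=
  [/\ {within closure Omega, continuous u},
      viscosity_solution Omega H u
    & forall x, boundary Omega x -> u x = g x].

End Viscosity.

Inductive reflectance (R : realType) : Type :=
| Lambert
| OrenNayar (sigma : R)
| Phong (kA kD kS : R) (alpha : nat)
| BlinnPhong (kA kD kS c : R).

Definition admissible (R : realType) (M : reflectance R) : Prop :=
  match M with
  | Lambert => True
  | OrenNayar sigma => 0 <= sigma < pi / 2
  | Phong kA kD kS alpha =>
      [/\ 0 <= kA, 0 < kD, 0 <= kS, kA + kD + kS = 1 & (1 <= alpha)%N]
  | BlinnPhong kA kD kS c =>
      [/\ 0 <= kA, 0 < kD, 0 <= kS, kA + kD + kS = 1 & 1 <= c]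
  end.

Section Hamiltonians.
Variable R : realType.
Implicit Types (f r sigma c : R) (x p : 'rV[R]_2).

Definition Q f x : R := f / Num.sqrt (f ^+ 2 + enorm x ^+ 2).

Definition W f x p : R :=
  (f ^+ 2 * enorm p ^+ 2 + dot p x ^+ 2) / Q f x ^+ 2.

Definition A_ON sigma : R :=
  1 - 1 / 2 * sigma ^+ 2 * (sigma ^+ 2 + 33 / 100)^-1.

Definition B_ON sigma : R :=
  45 / 100 * sigma ^+ 2 * (sigma ^+ 2 + 9 / 100)^-1.

Definition F_L r : R := Num.sqrt (r + 1).

Definition F_ON sigma r : R :=
  (r + 1) / (A_ON sigma * Num.sqrt (r + 1) + B_ON sigma * r).

Definition F_PH (kD kS : R) (alpha : nat) r : R :=
  if 1 <= r then Num.sqrt (r + 1) / kD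
  else (r + 1) `^ (alpha%:R + 1 / 2) /
       (kD * (r + 1) ^+ alpha + kS * (r + 1) `^ (1 / 2) * (1 - r) ^+ alpha).

Definition F_BP (kD kS c : R) r : R :=
  (r + 1) `^ (c / 2) / (kD * (r + 1) `^ ((c - 1) / 2) + kS).

Definition F (M : reflectance R) r : R :=
  match M with
  | Lambert => F_L r
  | OrenNayar sigma => F_ON sigma r
  | Phong _ kD kS alpha => F_PH kD kS alpha r
  | BlinnPhong _ kD kS c => F_BP kD kS c r
  end.

Definition effective_intensity (M : reflectance R) (I IA : 'rV[R]_2 -> R)
    (x : 'rV[R]_2) : R :=
  match M with
  | Lambert | OrenNayar _ => I x
  | Phong kA _ _ _ | BlinnPhong kA _ _ _ => I x - kA * IA x
  end.

Definition Hamiltonian (M : reflectance R) f (I IA : 'rV[R]_2 -> R)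
    (x : 'rV[R]_2) (r : R) (p : 'rV[R]_2) : R :=
  - expR (- 2 * r) + effective_intensity M I IA x * f ^+ 2 * F M (W f x p).

End Hamiltonians.

(* Main.v *)
Require Import Defs.
From mathcomp Require Import all_boot all_order all_algebra.
From mathcomp Require Import all_classical all_reals all_analysis.
From mathcomp Require Import ring lra.

(** Uniqueness is a comparison principle: a subsolution lying below a
    supersolution on the boundary lies below it on the whole closure. Two
    solutions with the same boundary values can be compared both ways.

    The comparison principle [comparison_principle] is the doubling of
    variables of Crandall and Lions. If [u x0 - v x0 = m > 0] somewhere,
    maximize [u x - v y - c |x - y|^2] over pairs of points of the compact
    closure. Comparing the maximum with the diagonal pair [(x, x)] bounds
    [c |x - y|^2] by [v x - v y], so that, as [c] grows, first [|x - y|] and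
    then, by uniform continuity of [v], also [c |x - y|^2] tends to 0. Since
    [u x - v y >= m] and [u <= v] on the boundary, both points are then interior.
    There the penalty is a test function for [u] in its first variable and for
    [v] in its second, with the common gradient [p = 2 c (x - y)], hence
    [H x (u x) p <= 0 <= H y (v y) p]. Strict monotonicity of [H] in its second
    argument makes [H y (v y) p - H x (v y) p] at least a positive constant,
    whereas a modulus of the form [C |x - y| (1 + |p|)] makes it tend to 0.

    It remains to check these two properties of the Hamiltonians. Monotonicity
    comes from the exponential ([Hamiltonian_strictly_increasing]). The modulus
    ([Hamiltonian_dist_le]) rests on two facts. First, in each of the models
    [F r] is a Lipschitz function of [sqrt (r + 1)] ([reflectance_lipschitz]);
    this follows from the common shape [F r = s / (a + b * theta s)] with
    [s = sqrt (r + 1)] and [s * theta t - t * theta s = O(s - t)]. Second, [W] is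
    quadratic in [p] and bounded below by [f^2 |p|^2], so that
    [sqrt (W x p + 1)] grows linearly in [p] and is Lipschitz in [x] with a
    constant proportional to [|p|] ([sqrt_W_upper], [sqrt_W_dist_le]). *)

Set Implicit Arguments.
Unset Strict Implicit.
Unset Printing Implicit Defensive.

Import Order.TTheory GRing.Theory Num.Theory.
Import numFieldNormedType.Exports.

Local Open Scope classical_set_scope.
Local Open Scope ring_scope.

(** * Reflectance functions *)

(** The variable [sqrt (r + 1)] is the natural one: at [r = W x p] it grows like
    [|p|], which is the growth that the comparison principle tolerates. *)
Definition lipschitz_in_sqrt (R : realType) (h : R -> R) : Prop :=
  exists2 L : R, 0 <= L & forall r r', 0 <= r -> 0 <= r' ->
    `|h r - h r'| <= L * `|Num.sqrt (r + 1) - Num.sqrt (r' + 1)|.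

(** Over the common denominator the difference has numerator
    [a (s - t) + b (s theta(t) - t theta(s))], and the denominator is at least
    [a ^+ 2] because [theta >= 0]. *)
Lemma quotient_dist_le (R : realType) (a b C s t ths tht : R) :
  0 < a -> 0 <= b -> 0 <= ths -> 0 <= tht ->
  `|s * tht - t * ths| <= C * `|s - t| ->
  `|s / (a + b * ths) - t / (a + b * tht)| <= (a + b * C) / a ^+ 2 * `|s - t|.
Proof.
move=> a0 b0 ths0 tht0 hC.
have Ds : a <= a + b * ths by rewrite lerDl mulr_ge0.
have Dt : a <= a + b * tht by rewrite lerDl mulr_ge0.
have Ds0 := lt_le_trans a0 Ds; have Dt0 := lt_le_trans a0 Dt.
have -> : s / (a + b * ths) - t / (a + b * tht) =
    (a * (s - t) + b * (s * tht - t * ths)) / ((a + b * ths) * (a + b * tht)).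
  by field; rewrite !gt_eqF.
rewrite normrM normfV [`|_ * (a + _)|]gtr0_norm ?mulr_gt0//.
rewrite ler_pdivrMr ?mulr_gt0//.
have num : `|a * (s - t) + b * (s * tht - t * ths)| <= (a + b * C) * `|s - t|.
  rewrite (le_trans (ler_normD _ _))// !normrM (gtr0_norm a0) (ger0_norm b0).
  by rewrite mulrDl lerD2l -mulrA ler_wpM2l.
have den : a ^+ 2 <= (a + b * ths) * (a + b * tht).
  by rewrite expr2 ler_pM// ltW.
apply: (le_trans num).
set P := (a + _) * _ in den *.
have -> : (a + b * C) / a ^+ 2 * `|s - t| * P =
  ((a + b * C) * `|s - t|) * (P / a ^+ 2) by ring.
rewrite ler_peMr ?(le_trans _ num)//.
by rewrite ler_pdivlMr ?exprn_gt0// mul1r.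
Qed.

(** The reduction used for all four models: what is left for each of them is a
    bound on the skew expression [s * theta t - t * theta s]. *)
Lemma quotient_lipschitz_in_sqrt (R : realType) (h theta : R -> R) (a b C : R) :
  0 < a -> 0 <= b -> 0 <= C ->
  (forall r, 0 <= r ->
     h r = Num.sqrt (r + 1) / (a + b * theta (Num.sqrt (r + 1)))) ->
  (forall s, 1 <= s -> 0 <= theta s) ->
  (forall s t, 1 <= s -> 1 <= t ->
     `|s * theta t - t * theta s| <= C * `|s - t|) ->
  lipschitz_in_sqrt h.
Proof.
move=> a0 b0 C0 hE th0 thC; exists ((a + b * C) / a ^+ 2).
  by rewrite divr_ge0 ?exprn_ge0 ?addr_ge0 ?mulr_ge0// ltW.
have sqrt_ge1 r : 0 <= r -> 1 <= Num.sqrt (r + 1).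
  by move=> r0; rewrite -[X in X <= _]sqrtr1 ler_wsqrtr// lerDr.
move=> r r' r0 r'0; rewrite !hE//.
by apply: quotient_dist_le; rewrite ?th0 ?thC ?sqrt_ge1.
Qed.

Lemma lambert_lipschitz (R : realType) : lipschitz_in_sqrt (@F_L R).
Proof.
apply: (@quotient_lipschitz_in_sqrt _ _ (fun=> 0) 1 0 0) => //.
- by move=> r r0; rewrite /F_L mul0r addr0 divr1.
- by move=> s t _ _; rewrite !mulr0 subrr normr0 mul0r.
Qed.

(** With [r = s ^+ 2 - 1] a factor [s] cancels, and [theta s = s - s^-1]. *)
Lemma oren_nayar_lipschitz (R : realType) (sigma : R) :
  lipschitz_in_sqrt (F_ON sigma).
Proof.
apply: (@quotient_lipschitz_in_sqrt _ _ (fun s => s - s^-1)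
  (A_ON sigma) (B_ON sigma) 2) => //.
- rewrite /A_ON subr_gt0 ltr_pdivrMr; last by rewrite ltr_wpDl ?sqr_ge0//; lra.
  have := sqr_ge0 sigma; lra.
- have := sqr_ge0 sigma; rewrite /B_ON; move: (sigma ^+ 2) => q q0.
  by rewrite divr_ge0//; lra.
- move=> r r0; rewrite /F_ON.
  set s := Num.sqrt (r + 1).
  have s0 : 0 < s by rewrite sqrtr_gt0; lra.
  have rE : r = s ^+ 2 - 1 by rewrite sqr_sqrtr; lra.
  rewrite {1 2}rE subrK.
  have -> : A_ON sigma * s + B_ON sigma * (s ^+ 2 - 1) =
     s * (A_ON sigma + B_ON sigma * (s - s^-1)) by field; rewrite gt_eqF.
  by rewrite invfM expr2 mulrA mulfK ?gt_eqF.
- move=> s s1; rewrite subr_ge0 (le_trans _ s1)//.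
  by rewrite invf_le1// (lt_le_trans ltr01).
- move=> s t s1 t1.
  have s0 : 0 < s := lt_le_trans ltr01 s1.
  have t0 : 0 < t := lt_le_trans ltr01 t1.
  have -> : s * (t - t^-1) - t * (s - s^-1) = - ((s^-1 + t^-1) * (s - t)).
    by field; rewrite !gt_eqF.
  rewrite normrN normrM ler_wpM2r//.
  rewrite ger0_norm; last by rewrite addr_ge0// invr_ge0 ltW.
  have : s^-1 <= 1 by rewrite invf_le1.
  have : t^-1 <= 1 by rewrite invf_le1.
  lra.
Qed.

Lemma inv_sqr_dist_le (R : realType) (s t : R) : 1 <= s -> 1 <= t ->
  s * t * `|2 / t ^+ 2 - 2 / s ^+ 2| <= 4 * `|s - t|.
Proof.
move=> s1 t1.
have s0 : 0 < s := lt_le_trans ltr01 s1.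
have t0 : 0 < t := lt_le_trans ltr01 t1.
rewrite -[X in X * `|_|](@gtr0_norm _ (s * t)) ?mulr_gt0// -normrM.
have -> : s * t * (2 / t ^+ 2 - 2 / s ^+ 2) = 2 * (s^-1 + t^-1) * (s - t).
  by field; rewrite !gt_eqF.
rewrite normrM ler_wpM2r//.
rewrite ger0_norm; last by rewrite mulr_ge0// addr_ge0// invr_ge0 ltW.
have : s^-1 <= 1 by rewrite invf_le1.
have : t^-1 <= 1 by rewrite invf_le1.
lra.
Qed.

Lemma expn_dist_le (R : realType) (n : nat) (x y : R) :
  0 <= x <= 1 -> 0 <= y <= 1 -> `|x ^+ n - y ^+ n| <= n%:R * `|x - y|.
Proof.
move=> /andP[x0 x1] /andP[y0 y1].
rewrite subrXX normrM mulrC ler_wpM2r// (le_trans (ler_norm_sum _ _ _))//.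
rewrite -[X in X%:R](card_ord n) -sumr_const ler_sum// => i _.
by rewrite ger0_norm ?mulr_ge0 ?exprn_ge0// mulr_ile1 ?exprn_ge0 ?exprn_ile1.
Qed.

(** The two branches of [F_PH] merge into one formula
    [s / (kD + kS * (s * z s ^+ alpha))]: dividing by [(r + 1) ^+ alpha] turns
    [(1 - r) ^+ alpha] into a power of [2 / s ^+ 2 - 1], whose positive part [z]
    vanishes exactly where the first branch applies. *)
Lemma phong_lipschitz (R : realType) (kD kS : R) (alpha : nat) :
  0 < kD -> 0 <= kS -> (1 <= alpha)%N -> lipschitz_in_sqrt (F_PH kD kS alpha).
Proof.
move=> kD0 kS0 alpha1.
pose z (s : R) := Num.max 0 (2 / s ^+ 2 - 1).
have z01 s : 1 <= s -> 0 <= z s <= 1.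
  move=> s1; rewrite le_max lexx/= ge_max ler01/= lerBlDr.
  by rewrite ler_pdivrMr ?exprn_gt0 ?(lt_le_trans ltr01)// ler_peMr ?exprn_ege1.
apply: (@quotient_lipschitz_in_sqrt _ _ (fun s => s * z s ^+ alpha)
  kD kS (4 * alpha%:R)) => //.
- move=> r r0; rewrite /F_PH.
  have r10 : 0 < r + 1 by lra.
  set s := Num.sqrt (r + 1).
  have s0 : 0 < s by rewrite sqrtr_gt0.
  have rE : r + 1 = s ^+ 2 by rewrite sqr_sqrtr; lra.
  have zE : 2 / s ^+ 2 - 1 = (1 - r) / (r + 1).
    by rewrite -rE; field; rewrite gt_eqF.
  have [r1|r1] := leP 1 r.
    rewrite /z zE max_l; last by rewrite pmulr_lle0 ?invr_gt0//; lra.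
    by rewrite expr0n -[alpha]prednK//= !mulr0 addr0.
  rewrite /z zE max_r; last by rewrite divr_ge0//; lra.
  rewrite powRD; last by rewrite gt_eqF// implybT.
  rewrite powR_mulrn; last lra.
  have -> : (r + 1) `^ (1 / 2) = s by rewrite div1r powR12_sqrt ?ltW.
  rewrite expr_div_n.
  have ra0 : 0 < (r + 1) ^+ alpha by rewrite exprn_gt0.
  have -> : kD * (r + 1) ^+ alpha + kS * s * (1 - r) ^+ alpha =
    (r + 1) ^+ alpha *
      (kD + kS * (s * ((1 - r) ^+ alpha / (r + 1) ^+ alpha))).
    by field; rewrite gt_eqF.
  by rewrite -mulf_div divff ?mul1r// gt_eqF.
- move=> s s1; have /andP[z0 _] := z01 s s1.
  by rewrite mulr_ge0 ?exprn_ge0// (le_trans ler01).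
- move=> s t s1 t1.
  have st0 : 0 < s * t by rewrite mulr_gt0 ?(lt_le_trans ltr01).
  have -> : s * (t * z t ^+ alpha) - t * (s * z s ^+ alpha) =
    s * t * (z t ^+ alpha - z s ^+ alpha) by ring.
  rewrite normrM gtr0_norm//.
  apply: (@le_trans _ _ (alpha%:R * (s * t * `|2 / t ^+ 2 - 2 / s ^+ 2|))).
    rewrite mulrCA ler_wpM2l ?(ltW st0)//.
    apply: (le_trans (expn_dist_le alpha (z01 t t1) (z01 s s1))).
    rewrite ler_wpM2l// /z.
    move: (2 / t ^+ 2) (2 / s ^+ 2) => p q.
    have := ler_norm (p - q); have := ler_norm (q - p).
    rewrite [`|q - p|]distrC.
    by case: (leP 0 (p - 1)); case: (leP 0 (q - 1)) => *; rewrite ler_norml;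
      lra.
  have -> : 4 * alpha%:R * `|s - t| = alpha%:R * (4 * `|s - t|) by ring.
  rewrite ler_wpM2l//.
  by rewrite inv_sqr_dist_le.
Qed.

(** The function [t `^ (1 - c)] decreases with values in (0, 1]; its decrease
    between [t] and [s] is estimated through Bernoulli's inequality
    [(s / t) `^ (1 - c) >= 1 + (1 - c) * (s / t - 1)], that is, through the
    tangent lines of the exponential and of the logarithm. *)
Lemma powRN_dist_le (R : realType) (c s t : R) : 1 <= c -> 1 <= s -> 1 <= t ->
  `|s * t `^ (1 - c) - t * s `^ (1 - c)| <= c * `|s - t|.
Proof.
move=> c1; wlog ts : s t / t <= s => [H s1 t1|s1 t1].
  have [/H|/ltW/H] := leP t s; first exact.
  by rewrite distrC [`|t - s|]distrC; exact.
have s0 : 0 < s := lt_le_trans ltr01 s1.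
have t0 : 0 < t := lt_le_trans ltr01 t1.
set q := t `^ (1 - c); set q' := s `^ (1 - c).
have q0 : 0 < q by rewrite powR_gt0.
have q1 : q <= 1 by rewrite -(powRr0 t) ler_powR//; lra.
have qq' : q' <= q.
  rewrite /q /q' -[1 - c]opprB !powRN lef_pV2 ?posrE ?powR_gt0//.
  by rewrite ge0_ler_powR// ?nnegrE ?subr_ge0// ltW.
have hq' : t * (q - q') <= (c - 1) * (s - t).
  have -> : q' = q * (s / t) `^ (1 - c).
    by rewrite /q -powRM ?divr_ge0 ?ltW// mulrC divfK// gt_eqF.
  have h : 1 + (1 - c) * (s / t - 1) <= (s / t) `^ (1 - c).
    rewrite /powR gt_eqF ?divr_gt0//.
    apply: le_trans (expR_ge1Dx _); rewrite lerD2l.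
    rewrite ler_wnM2l//; first lra.
    have -> : s / t = 1 + (s / t - 1) by ring.
    rewrite (le_trans (le_ln1Dx _))//; first last.
      by rewrite addrAC subrr add0r.
    have := divr_gt0 s0 t0; lra.
  have hh : t * (1 - (s / t) `^ (1 - c)) <= (c - 1) * (s - t).
    have -> : (c - 1) * (s - t) = t * (1 - (1 + (1 - c) * (s / t - 1))).
      by field; rewrite gt_eqF.
    by rewrite ler_wpM2l ?(ltW t0)// lerD2l lerN2.
  have -> : t * (q - q * (s / t) `^ (1 - c)) =
            q * (t * (1 - (s / t) `^ (1 - c))) by ring.
  apply: (@le_trans _ _ (q * ((c - 1) * (s - t)))).
    by rewrite ler_wpM2l// ltW.
  by rewrite ler_piMl// mulr_ge0//; lra.
have -> : s * q - t * q' = (s - t) * q + t * (q - q') by ring.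
have t1q : 0 <= t * (q - q') by rewrite mulr_ge0 ?subr_ge0// ltW.
have t2q : 0 <= (s - t) * q by rewrite mulr_ge0 ?subr_ge0// ltW.
have t3q : (s - t) * q <= s - t by rewrite ler_piMr// subr_ge0.
rewrite (ger0_norm (addr_ge0 t2q t1q)) ger0_norm ?subr_ge0//.
have -> : c * (s - t) = (s - t) + (c - 1) * (s - t) by ring.
exact: lerD.
Qed.

(** Dividing by [s `^ (c - 1)] gives [theta s = s `^ (1 - c)]. *)
Lemma blinn_phong_lipschitz (R : realType) (kD kS c : R) :
  0 < kD -> 0 <= kS -> 1 <= c -> lipschitz_in_sqrt (F_BP kD kS c).
Proof.
move=> kD0 kS0 c1.
apply: (@quotient_lipschitz_in_sqrt _ _ (fun s => s `^ (1 - c)) kD kS c) => //.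
- by rewrite (le_trans ler01).
- move=> r r0; rewrite /F_BP.
  have r10 : 0 < r + 1 by lra.
  have sE : Num.sqrt (r + 1) = (r + 1) `^ 2^-1 by rewrite powR12_sqrt// ltW.
  have s0 : 0 < Num.sqrt (r + 1) by rewrite sqrtr_gt0.
  rewrite [c / 2]mulrC [(c - 1) / 2]mulrC !powRrM -sE.
  set s := Num.sqrt (r + 1) in s0 *.
  have -> : s `^ c = s * s `^ (c - 1).
    rewrite -{2}[s]powRr1 ?(ltW s0)// -powRD.
      by rewrite addrC subrK.
    by rewrite (gt_eqF s0) implybT.
  rewrite -[1 - c]opprB powRN.
  have q0 : 0 < s `^ (c - 1) by rewrite powR_gt0.
  have D0 : 0 < kD * s `^ (c - 1) + kS by rewrite ltr_pwDl// mulr_gt0.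
  by field; rewrite !gt_eqF.
- by move=> s _; rewrite powR_ge0.
- by move=> s t s1 t1; exact: powRN_dist_le.
Qed.

Lemma reflectance_lipschitz (R : realType) (M : reflectance R) :
  admissible M -> lipschitz_in_sqrt (F M).
Proof.
case: M => [_|sigma _|kA kD kS alpha [_ kD0 kS0 _ a1]|
  kA kD kS c [_ kD0 kS0 _ c1]].
- exact: lambert_lipschitz.
- exact: oren_nayar_lipschitz.
- exact: phong_lipschitz.
- exact: blinn_phong_lipschitz.
Qed.

(** * The Euclidean norm on the plane *)

Section Euclid.
Variable R : realType.
Implicit Types (x y p : 'rV[R]_2).

Lemma dotE x y :
  dot x y = x ord0 ord0 * y ord0 ord0 + x ord0 ord_max * y ord0 ord_max.
Proof.
rewrite /dot big_ord_recl big_ord1.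
by have -> : lift ord0 ord0 = ord_max :> 'I_2 by exact/val_inj.
Qed.

Lemma sqr_enorm x : enorm x ^+ 2 = dot x x.
Proof. by rewrite sqr_sqrtr// dotE addr_ge0// -expr2 sqr_ge0. Qed.

Lemma enorm_ge0 x : 0 <= enorm x.
Proof. exact: sqrtr_ge0. Qed.

Lemma cauchy_schwarz p x : `|dot p x| <= enorm p * enorm x.
Proof.
rewrite -[leRHS]ger0_norm ?mulr_ge0 ?enorm_ge0// -ler_sqr ?nnegrE//.
rewrite !real_normK ?num_real// exprMn !sqr_enorm !dotE -subr_ge0.
set a := p _ _; set b := p _ _; set c := x _ _; set d := x _ _.
have -> : (a * a + b * b) * (c * c + d * d) - (a * c + b * d) ^+ 2 =
  (a * d - b * c) ^+ 2 by ring.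
exact: sqr_ge0.
Qed.

Lemma enormZ (c : R) x : 0 <= c -> enorm (c *: x) = c * enorm x.
Proof.
move=> c0; have -> : enorm (c *: x) = Num.sqrt (c ^+ 2 * dot x x).
  by congr Num.sqrt; rewrite !dotE !mxE; ring.
by rewrite sqrtrM ?sqr_ge0// sqrtr_sqr ger0_norm.
Qed.

Lemma norm_le_enorm x : `|x| <= enorm x.
Proof.
rewrite [leLHS]/Num.Def.normr/= mx_normrE; apply: bigmax_le => [|[i j] _ /=].
  exact: enorm_ge0.
rewrite -ler_sqr ?nnegrE ?enorm_ge0// sqr_enorm real_normK ?num_real//.
rewrite dotE -!expr2 (ord1 i).
have := sqr_ge0 (x ord0 ord0); have := sqr_ge0 (x ord0 ord_max).
have : (j == ord0) || (j == ord_max) by case: j => -[|[]].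
by case/orP => /eqP ->; lra.
Qed.

Lemma enorm_le_norm x : enorm x <= 2 * `|x|.
Proof.
have h j : `|x ord0 j| <= `|x|.
  rewrite [leRHS]/Num.Def.normr/= mx_normrE.
  by rewrite (le_trans _ (le_bigmax _ _ (ord0, j))).
rewrite -ler_sqr ?nnegrE ?enorm_ge0 ?mulr_ge0// sqr_enorm dotE -!expr2.
rewrite -[x ord0 ord0 ^+ 2]real_normK ?num_real//.
rewrite -[x ord0 ord_max ^+ 2]real_normK ?num_real//.
have := h ord0; have := h ord_max; have := normr_ge0 (x ord0 ord0).
have := normr_ge0 (x ord0 ord_max).
move: (`|x|) (`|x ord0 ord0|) (`|x ord0 ord_max|) => a b c *; nra.
Qed.

Lemma dotDr p x y : dot p (x + y) = dot p x + dot p y.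
Proof. by rewrite !dotE !mxE; ring. Qed.

Lemma dotNr p x : dot p (- x) = - dot p x.
Proof. by rewrite !dotE !mxE; ring. Qed.

Lemma dotC x y : dot x y = dot y x.
Proof. by rewrite !dotE; ring. Qed.

(** Difference of squares: [(p.x)^2 - (p.y)^2 = p.(x - y) (p.x + p.y)]. *)
Lemma sqr_dot_dist_le p x y (rho : R) : enorm x <= rho -> enorm y <= rho ->
  `|dot p x ^+ 2 - dot p y ^+ 2| <= 2 * rho * enorm (x - y) * enorm p ^+ 2.
Proof.
move=> xr yr.
have -> : dot p x ^+ 2 - dot p y ^+ 2 = dot p (x - y) * (dot p x + dot p y).
  by rewrite dotDr dotNr; ring.
rewrite normrM.
have -> : 2 * rho * enorm (x - y) * enorm p ^+ 2 =
  (enorm p * enorm (x - y)) * (2 * rho * enorm p) by ring.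
apply: ler_pM => //; first exact: cauchy_schwarz.
have -> : 2 * rho * enorm p = enorm p * rho + enorm p * rho by ring.
rewrite (le_trans (ler_normD _ _))// lerD// (le_trans (cauchy_schwarz _ _))//.
  by rewrite ler_wpM2l ?enorm_ge0.
by rewrite ler_wpM2l ?enorm_ge0.
Qed.

Lemma sqr_enorm_dist_le x y (rho : R) : enorm x <= rho -> enorm y <= rho ->
  `|enorm x ^+ 2 - enorm y ^+ 2| <= 2 * rho * enorm (x - y).
Proof.
move=> xr yr; rewrite !sqr_enorm.
have -> : dot x x - dot y y = dot (x - y) x + dot (x - y) y.
  by rewrite !dotE !mxE; ring.
have -> : 2 * rho * enorm (x - y) = enorm (x - y) * rho + enorm (x - y) * rho.
  by ring.
rewrite (le_trans (ler_normD _ _))// lerD// (le_trans (cauchy_schwarz _ _))//.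
  by rewrite ler_wpM2l ?enorm_ge0.
by rewrite ler_wpM2l ?enorm_ge0.
Qed.

End Euclid.

(** * The quadratic form W *)

Section WEstimates.
Variables (R : realType) (f : R).
Hypothesis f_gt0 : 0 < f.
Implicit Types (x y p : 'rV[R]_2).

Lemma WE x p : W f x p =
  (f ^+ 2 * enorm p ^+ 2 + dot p x ^+ 2) * (f ^+ 2 + enorm x ^+ 2) / f ^+ 2.
Proof.
have D0 : 0 < f ^+ 2 + enorm x ^+ 2 by rewrite ltr_pwDl ?exprn_gt0 ?sqr_ge0.
rewrite /W.
have -> : Q f x ^+ 2 = f ^+ 2 / (f ^+ 2 + enorm x ^+ 2).
  by rewrite /Q expr_div_n sqr_sqrtr ?(ltW D0).
by field; rewrite !gt_eqF.
Qed.

(** This lower bound turns the Lipschitz bound on [W], which is quadratic in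
    [p], into one on its square root that is linear in [p]. *)
Lemma W_lower x p : f ^+ 2 * enorm p ^+ 2 <= W f x p.
Proof.
rewrite WE ler_pdivlMr ?exprn_gt0//.
have f2 : 0 < f ^+ 2 by rewrite exprn_gt0.
by apply: ler_pM; rewrite ?lerDl ?sqr_ge0 ?(mulr_ge0 (sqr_ge0 _) (sqr_ge0 _)).
Qed.

Lemma W_ge0 x p : 0 <= W f x p.
Proof.
by rewrite (le_trans _ (W_lower x p))// (mulr_ge0 (sqr_ge0 _) (sqr_ge0 _)).
Qed.

Lemma sqrt_W_upper x p (rho : R) : enorm x <= rho ->
  Num.sqrt (W f x p + 1) <= 1 + (f ^+ 2 + rho ^+ 2) / f * enorm p.
Proof.
move=> xr; have P0 := enorm_ge0 p; have X0 := enorm_ge0 x.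
set b := (f ^+ 2 + rho ^+ 2) / f.
have b0 : 0 <= b by rewrite divr_ge0 ?(ltW f_gt0) ?addr_ge0 ?sqr_ge0.
have B0 : 0 <= 1 + b * enorm p by rewrite addr_ge0// mulr_ge0.
rewrite -[leRHS]ger0_norm// -sqrtr_sqr ler_wsqrtr//.
suff : W f x p <= (b * enorm p) ^+ 2.
  have : 0 <= b * enorm p by rewrite mulr_ge0.
  move: (b * _) => z; nra.
rewrite WE ler_pdivrMr ?exprn_gt0//.
have -> : (b * enorm p) ^+ 2 * f ^+ 2 =
    ((f ^+ 2 + rho ^+ 2) * enorm p ^+ 2) * (f ^+ 2 + rho ^+ 2).
  by rewrite /b; field; rewrite gt_eqF.
have xr2 : enorm x ^+ 2 <= rho ^+ 2.
  by rewrite ler_sqr ?nnegrE// (le_trans X0).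
apply: ler_pM.
- by rewrite addr_ge0 ?sqr_ge0// (mulr_ge0 (sqr_ge0 _) (sqr_ge0 _)).
- by rewrite addr_ge0 ?sqr_ge0.
- rewrite mulrDl lerD2l -real_normK ?num_real//.
  apply: (@le_trans _ _ ((enorm p * enorm x) ^+ 2)).
    by rewrite ler_sqr ?nnegrE ?mulr_ge0// cauchy_schwarz.
  by rewrite exprMn mulrC ler_wpM2r ?sqr_ge0.
- by rewrite lerD2l.
Qed.

Lemma W_dist_le x y p (rho : R) : enorm x <= rho -> enorm y <= rho ->
  `|W f x p - W f y p| <=
  4 * rho * (f ^+ 2 + rho ^+ 2) / f ^+ 2 * enorm (x - y) * enorm p ^+ 2.
Proof.
move=> xr yr; rewrite !WE.
have f2 : 0 < f ^+ 2 by rewrite exprn_gt0.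
have X0 := enorm_ge0 x; have Y0 := enorm_ge0 y.
have xr2 : enorm x ^+ 2 <= rho ^+ 2 by rewrite ler_sqr ?nnegrE// (le_trans X0).
have yr2 : enorm y ^+ 2 <= rho ^+ 2 by rewrite ler_sqr ?nnegrE// (le_trans X0).
have hy : dot p y ^+ 2 <= rho ^+ 2 * enorm p ^+ 2.
  rewrite -real_normK ?num_real//.
  apply: (@le_trans _ _ ((enorm p * enorm y) ^+ 2)).
    by rewrite ler_sqr ?nnegrE ?mulr_ge0 ?enorm_ge0// cauchy_schwarz.
  by rewrite exprMn mulrC ler_wpM2r ?sqr_ge0.
have d1 := sqr_dot_dist_le p xr yr; have d2 := sqr_enorm_dist_le xr yr.
move: d1 d2 hy (sqr_ge0 (dot p y)) (sqr_ge0 (enorm x)) (sqr_ge0 (enorm p)).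
move: xr2 yr2.
set ax := dot p x ^+ 2; set ay := dot p y ^+ 2.
set bx := enorm x ^+ 2; set b_y := enorm y ^+ 2; set P := enorm p ^+ 2.
move=> xr2 yr2 d1 d2 hy ay0 bx0 P0.
rewrite -mulrBl normrM (@gtr0_norm _ (f ^+ 2)^-1) ?invr_gt0//.
rewrite ler_pdivrMr//.
have -> : 4 * rho * (f ^+ 2 + rho ^+ 2) / f ^+ 2 * enorm (x - y) * P * f ^+ 2 =
  2 * rho * enorm (x - y) * P * (f ^+ 2 + rho ^+ 2) +
  (f ^+ 2 + rho ^+ 2) * P * (2 * rho * enorm (x - y)).
  by field; rewrite gt_eqF.
have -> : (f ^+ 2 * P + ax) * (f ^+ 2 + bx) - (f ^+ 2 * P + ay) * (f ^+ 2 + b_y)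
  = (ax - ay) * (f ^+ 2 + bx) + (f ^+ 2 * P + ay) * (bx - b_y) by ring.
have e1 : 0 <= f ^+ 2 + bx by rewrite addr_ge0 ?(ltW f2).
have e2 : 0 <= f ^+ 2 * P + ay by rewrite addr_ge0// mulr_ge0// ltW.
rewrite (le_trans (ler_normD _ _))// !normrM (ger0_norm e1) (ger0_norm e2).
apply: lerD; apply: ler_pM => //; first by rewrite lerD2l.
by rewrite mulrDl lerD2l.
Qed.

(** Divide [W_dist_le] by the sum of the two square roots, which is at least
    [f * enorm p]. *)
Lemma sqrt_W_dist_le x y p (rho : R) : enorm x <= rho -> enorm y <= rho ->
  `|Num.sqrt (W f x p + 1) - Num.sqrt (W f y p + 1)| <=
  4 * rho * (f ^+ 2 + rho ^+ 2) / f ^+ 3 * enorm (x - y) * enorm p.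
Proof.
move=> xr yr; have P0 := enorm_ge0 p.
have h := W_dist_le p xr yr.
set s := Num.sqrt (W f x p + 1); set t := Num.sqrt (W f y p + 1).
have st : W f x p - W f y p = (s - t) * (s + t).
  rewrite -subr_sqr !sqr_sqrtr ?addr_ge0 ?W_ge0//; ring.
have s0 : 0 < s by rewrite sqrtr_gt0 ltr_wpDl ?W_ge0.
have t0 : 0 < t by rewrite sqrtr_gt0 ltr_wpDl ?W_ge0.
have fPs : f * enorm p <= s + t.
  have fP0 : 0 <= f * enorm p by rewrite mulr_ge0 ?(ltW f_gt0).
  rewrite (@le_trans _ _ s)// ?lerDl ?(ltW t0)//.
  rewrite -[leLHS]ger0_norm// -sqrtr_sqr ler_wsqrtr// exprMn.
  by rewrite (le_trans (W_lower x p))// lerDl.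
rewrite st normrM (gtr0_norm (addr_gt0 s0 t0)) in h.
(* For p = 0 the division is impossible, but both square roots are equal. *)
have [p0|pn0] := eqVneq (enorm p) 0.
  move: h; rewrite p0 expr0n/= !mulr0 pmulr_lle0 ?addr_gt0//.
have pp : 0 < f * enorm p by rewrite mulr_gt0// lt_def pn0.
rewrite -(ler_pM2r pp); apply: (@le_trans _ _ (`|s - t| * (s + t))).
  by rewrite ler_wpM2l.
apply: (le_trans h).
by rewrite le_eqVlt; apply/orP; left; apply/eqP; field; rewrite gt_eqF.
Qed.

End WEstimates.

(** * The Hamiltonians *)

Section HamiltonianEstimates.
Variables (R : realType) (Omega : set 'rV[R]_2) (f : R) (M : reflectance R).
Variables (I IA : 'rV[R]_2 -> R).
Hypotheses (f_gt0 : 0 < f) (F_lipschitz : lipschitz_in_sqrt (F M)).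

(** On bounded values the slope of [- expR (- 2 * r)] is bounded below by
    [2 expR (- 2 B)]. *)
Lemma Hamiltonian_strictly_increasing (B m : R) : 0 < m ->
  exists2 gamma, 0 < gamma &
    forall x p r s, `|s| <= B -> r + m <= s ->
      Hamiltonian M f I IA x r p + gamma <= Hamiltonian M f I IA x s p.
Proof.
move=> m0; exists (expR (- 2 * B) * (2 * m)).
  by rewrite mulr_gt0 ?expR_gt0 ?mulr_gt0.
move=> x p r s sB rms; rewrite /Hamiltonian.
suff : expR (- 2 * s) + expR (- 2 * B) * (2 * m) <= expR (- 2 * r) by lra.
have e1 : expR (- 2 * s) * expR (2 * m) <= expR (- 2 * r).
  by rewrite -expRD ler_expR; lra.
have e2 : 1 + 2 * m <= expR (2 * m) := expR_ge1Dx _.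
have e3 : expR (- 2 * B) <= expR (- 2 * s).
  by rewrite ler_expR; move: sB; rewrite ler_norml; lra.
have e4 : expR (- 2 * s) * (1 + 2 * m) <= expR (- 2 * s) * expR (2 * m).
  by rewrite ler_wpM2l// expR_ge0.
have e5 : expR (- 2 * B) * (2 * m) <= expR (- 2 * s) * (2 * m).
  by rewrite ler_wpM2r// mulr_ge0// ltW.
lra.
Qed.

Lemma F_W_growth (rho : R) : exists2 C : R, 0 <= C &
  forall x p, enorm x <= rho -> `|F M (W f x p)| <= C * (1 + enorm p).
Proof.
have [L L0 hL] := F_lipschitz.
pose b := (f ^+ 2 + rho ^+ 2) / f.
have b0 : 0 <= b by rewrite divr_ge0 ?(ltW f_gt0)// addr_ge0 ?sqr_ge0.
exists (`|F M 0| + L * b) => [|x p xr]; first by rewrite addr_ge0// mulr_ge0.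
have P0 := enorm_ge0 p.
have h := hL _ _ (W_ge0 f_gt0 x p) (lexx 0).
have s1 : 1 <= Num.sqrt (W f x p + 1).
  by rewrite -[X in X <= _]sqrtr1 ler_wsqrtr// lerDr W_ge0.
rewrite add0r sqrtr1 (ger0_norm (_ : 0 <= _ - 1)) ?subr_ge0// in h.
have h2 : L * (Num.sqrt (W f x p + 1) - 1) <= L * (b * enorm p).
  rewrite ler_wpM2l// lerBlDl; exact: sqrt_W_upper.
rewrite -[F M _](subrK (F M 0)) (le_trans (ler_normD _ _))//.
have Lb : 0 <= L * b by rewrite mulr_ge0.
have : 0 <= `|F M 0| * enorm p by rewrite mulr_ge0.
have -> : (`|F M 0| + L * b) * (1 + enorm p) =
  `|F M 0| + L * b + `|F M 0| * enorm p + L * (b * enorm p) by ring.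
lra.
Qed.

Lemma F_W_dist_le (rho : R) : 0 <= rho -> exists2 C : R, 0 <= C &
  forall x y p, enorm x <= rho -> enorm y <= rho ->
    `|F M (W f y p) - F M (W f x p)| <= C * (enorm (x - y) * enorm p).
Proof.
move=> rho0; have [L L0 hL] := F_lipschitz.
pose k := 4 * rho * (f ^+ 2 + rho ^+ 2) / f ^+ 3.
have k0 : 0 <= k.
  rewrite divr_ge0 ?exprn_ge0 ?(ltW f_gt0)// mulr_ge0 ?mulr_ge0//.
  by rewrite addr_ge0 ?sqr_ge0.
exists (L * k) => [|x y p xr yr]; first by rewrite mulr_ge0.
rewrite distrC (le_trans (hL _ _ (W_ge0 f_gt0 x p) (W_ge0 f_gt0 y p)))//.
rewrite -mulrA ler_wpM2l// mulrA; exact: sqrt_W_dist_le.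
Qed.

(** Write the difference of the products [J * F] as
    [(J y - J x) F(y) + J x (F(y) - F(x))]: the first term uses the Lipschitz
    constant of [J] and the linear growth of [F] in [p], the second the bound of
    [J] on the bounded set and the Lipschitz estimate of [F] in [x]. *)
Lemma Hamiltonian_dist_le :
  bounded_set Omega ->
  [lipschitz (effective_intensity M I IA x) | x in Omega] ->
  exists2 C : R, 0 <= C & forall x y r p, Omega x -> Omega y ->
    Hamiltonian M f I IA y r p - Hamiltonian M f I IA x r p <=
    C * (enorm (x - y) * (1 + enorm p)).
Proof.
set J := effective_intensity M I IA => bO Jlip.
have [rho rho0 hrho] : exists2 rho : R, 0 <= rho &
    forall x, Omega x -> enorm x <= rho.
  have [rho rho0 h] := ex_strict_bound_gt0 bO.
  exists (2 * rho) => [|x /h xr]; first by rewrite mulr_ge0// ltW.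
  by rewrite (le_trans (enorm_le_norm x))// ler_wpM2l// ltW.
have [k k0 hk] : exists2 k : R, 0 <= k &
    forall x y, Omega x -> Omega y -> `|J x - J y| <= k * enorm (x - y).
  have [k [k0 h]] := filter_ex (filterI (nbhs_pinfty_ge (num_real 0)) Jlip).
  exists k => // x y Ox Oy; rewrite (le_trans (h (x, y) _))//=.
  by rewrite ler_wpM2l// norm_le_enorm.
have [B B0 hB] : exists2 B : R, 0 <= B & forall x, Omega x -> `|J x| <= B.
  have [[x0 Ox0]|/nonemptyPn O0] := pselect (Omega !=set0); last first.
    by exists 0 => // x; rewrite O0.
  exists (`|J x0| + k * (2 * (2 * rho))) => [|x Ox].
    by rewrite addr_ge0 ?mulr_ge0.
  rewrite -[J x](subrK (J x0)) addrC (le_trans (ler_normD _ _))// lerD2l.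
  rewrite (le_trans (hk _ _ Ox Ox0))// ler_wpM2l//.
  rewrite (le_trans (enorm_le_norm _))// ler_wpM2l//.
  rewrite (le_trans (ler_normB _ _))//.
  rewrite mulr_natl mulr2n lerD// (le_trans (norm_le_enorm _))//; exact: hrho.
have [G G0 hG] := F_W_growth rho.
have [N N0 hN] := F_W_dist_le rho0.
have f2 := sqr_ge0 f.
exists (f ^+ 2 * (k * G + B * N)) => [|x y r p Ox Oy].
  by rewrite mulr_ge0// addr_ge0// mulr_ge0.
rewrite /Hamiltonian -/J.
set Fx := F M (W f x p); set Fy := F M (W f y p).
have -> : - expR (- 2 * r) + J y * f ^+ 2 * Fy -
    (- expR (- 2 * r) + J x * f ^+ 2 * Fx) =
    f ^+ 2 * ((J y - J x) * Fy + J x * (Fy - Fx)) by ring.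
rewrite -[leRHS]mulrA ler_wpM2l//.
set D := enorm (x - y); have D0 : 0 <= D := enorm_ge0 _.
have P0 := enorm_ge0 p.
rewrite (le_trans (ler_norm _))// (le_trans (ler_normD _ _))// !normrM.
rewrite mulrDl; apply: lerD.
  apply: (@le_trans _ _ ((k * D) * (G * (1 + enorm p)))).
    by apply: ler_pM => //; [rewrite distrC; exact: hk|apply: hG; exact: hrho].
  by rewrite le_eqVlt; apply/orP; left; apply/eqP; ring.
apply: (@le_trans _ _ (B * (N * (D * enorm p)))).
  by apply: ler_pM => //; [exact: hB|apply: hN; exact: hrho].
rewrite -[leRHS]mulrA ler_wpM2l// ler_wpM2l// ler_wpM2l//; lra.
Qed.

End HamiltonianEstimates.

(** * The penalization as a test function *)

Section Penalization.
Variables (R : realType) (c : R) (a : 'rV[R]_2).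

Lemma derive_coord (m n : nat) i j (x v : 'M[R]_(m, n)) :
  'D_v (fun z : 'M[R]_(m, n) => z i j) x = v i j.
Proof.
have := @derive_mx R _ m n id x v (@derivable_id _ _ x v).
by rewrite derive_id => /matrixP /(_ i j); rewrite mxE.
Qed.

Let sqdist (x : 'rV[R]_2) := c * dot (x - a) (x - a).
Let g j (x : 'rV[R]_2) := x ord0 j - a ord0 j.

Let sqdistE : sqdist = c \*: (g ord0 * g ord0 + g ord_max * g ord_max).
Proof. by apply/funext => x; rewrite /sqdist dotE !mxE. Qed.

Let differentiable_g j x : differentiable (g j) x.
Proof.
exact: differentiableB (differentiable_coord _ _ _) (differentiable_cst _ _).
Qed.

Let derive_g j x v : 'D_v (g j) x = v ord0 j.
Proof.
rewrite deriveB; last 2 first.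
- exact/diff_derivable/differentiable_coord.
- exact: derivable_cst.
by rewrite derive_coord derive_cst subr0.
Qed.

Lemma grad_sqdist (x : 'rV[R]_2) :
  grad (fun z => c * dot (z - a) (z - a)) x = (2 * c) *: (x - a).
Proof.
apply/rowP => j; rewrite !mxE -/sqdist sqdistE.
have dg k : derivable (g k) x (delta_mx ord0 j) by exact/diff_derivable.
rewrite deriveZ; last by apply: derivableD; exact: derivableM.
rewrite deriveD; [|exact: derivableM..].
rewrite !deriveM// !derive_g !mxE/= {dg}/g.
have : (j == ord0) || (j == ord_max) by case: j => -[|[]].
case/orP => /eqP -> /=; rewrite /GRing.scale/=; ring.
Qed.

Lemma C1_on_sqdist (Omega : set 'rV[R]_2) :
  C1_on Omega (fun z => c * dot (z - a) (z - a)).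
Proof.
split=> [x _|].
  rewrite -/sqdist sqdistE; apply: differentiableZ.
  by apply: differentiableD; exact: differentiableM.
rewrite (funext grad_sqdist); apply: continuous_subspaceT => x.
have cB : continuous (fun z : 'rV[R]_2 => z - a).
  by move=> z; exact: (cvgB cvg_id (cvg_cst _)).
exact: (continuous_comp (cB x) (@scaler_continuous _ _ (2 * c) (x - a))).
Qed.

End Penalization.

(** * Compactness *)

Section Compact.
Variable R : realType.

(** Heine-Cantor theorem. The near-covering form of compactness turns the local
    radii of continuity into a single one. *)
Lemma compact_uniform_continuity (V : normedModType R) (K : set V)
    (u : V -> R) :
  compact K -> {within K, continuous u} -> forall e, 0 < e ->
  exists2 d, 0 < d &
    forall x y, K x -> K y -> `|x - y| < d -> `|u x - u y| < e.
Proof.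
move=> /compact_near_coveringP cK cu e e0.
have : \forall d \near (0 : R)^'+, K `<=`
   (fun x => K x -> forall y, K y -> `|x - y| < d -> `|u x - u y| < e).
  apply: cK => x Kx.
  move/subspace_continuousP : cu => /(_ x Kx) /cvgrPdist_lt /(_ (e / 2)).
  move=> /(_ (divr_gt0 e0 (ltr0n _ 2))); rewrite near_withinE.
  case/nbhs_ballP => r /= r0 hr.
  have r20 : 0 < r / 2 by rewrite divr_gt0.
  exists (ball x (r / 2), [set d | d < r / 2]).
    split; first exact: nbhsx_ballx.
    exact: nbhs_right_lt.
  move=> [x' d]/= [xx' dr] Kx' y Ky x'y.
  have xx'2 : `|x - x'| < r / 2 by move: xx'; rewrite -ball_normE.
  have h1 : `|u x - u x'| < e / 2.
    apply: hr => //; rewrite -ball_normE /=; lra.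
  have h2 : `|u x - u y| < e / 2.
    apply: hr => //; rewrite -ball_normE /=.
    rewrite -(subrKA x') (le_lt_trans (ler_normD _ _))//; lra.
  rewrite -(subrKA (u x)) (le_lt_trans (ler_normD _ _))//.
  rewrite distrC; lra.
move=> H; have [d [d0 Hd]] := filter_ex (filterI (nbhs_right_gt 0) H).
by exists d => // x y Kx; exact: Hd.
Qed.

Lemma bounded_set_closure (V : normedModType R) (A : set V) :
  bounded_set A -> bounded_set (closure A).
Proof.
move=> [M [Mreal hM]]; exists M; split => // N MN x Ax.
have clN : closed [set z : V | `|z| <= N].
  apply: (@closed_comp _ _ (fun z : V => `|z|) [set t | t <= N]).
    by move=> z _; exact: norm_continuous.
  exact: closed_le.
by move/closure_id : clN => ->; apply: closure_subset Ax => z; exact: hM.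
Qed.

Lemma compact_bounded (T : topologicalType) (K : set T) (u : T -> R) :
  compact K -> {within K, continuous u} ->
  exists2 B, 0 <= B & forall x, K x -> `|u x| <= B.
Proof.
move=> cK cu; have [K0|/nonemptyPn K0] := pselect (K !=set0); last first.
  by exists 0 => // x; rewrite K0.
have [y _ hy] := compact_EVT_max K0 cK cu.
have [z _ hz] := compact_EVT_min K0 cK cu.
exists (`|u y| + `|u z|) => [|x Kx]; first by rewrite addr_ge0.
have := hy x (mem_set Kx); have := hz x (mem_set Kx).
have := ler_norm (u y); have := lerNnormlW (lexx `|u z|).
have := normr_ge0 (u y); have := normr_ge0 (u z).
rewrite ler_norml; lra.
Qed.

Lemma penalized_max (K : set 'rV[R]_2) (u v : 'rV[R]_2 -> R) (c : R) :
  K !=set0 -> compact K ->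
  {within K, continuous u} -> {within K, continuous v} ->
  exists x y, [/\ K x, K y & forall x' y', K x' -> K y' ->
    u x' - v y' - c * dot (x' - y') (x' - y') <=
    u x - v y - c * dot (x - y) (x - y)].
Proof.
move=> [x0 Kx0] cK cu cv.
pose Phi (z : 'rV[R]_2 * 'rV[R]_2) :=
  u z.1 - v z.2 - c * dot (z.1 - z.2) (z.1 - z.2).
have KK0 : (K `*` K) !=set0 by exists (x0, x0).
have cPhi : {within K `*` K, continuous Phi}.
  apply/subspace_continuousP => -[x y] /= [Kx Ky].
  have cxy : (z.1 - z.2 @[z --> (x, y)]) --> x - y.
    exact: cvgB cvg_fst cvg_snd.
  have cj (j : 'I_2) :
      ((z.1 - z.2 : 'rV[R]_2) ord0 j) @[z --> (x, y)] --> (x - y) ord0 j.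
    exact: cvg_comp cxy (@coord_continuous _ _ _ ord0 j (x - y)).
  have cdot : dot (z.1 - z.2) (z.1 - z.2) @[z --> (x, y)] -->
      dot (x - y) (x - y).
    rewrite dotE; under eq_fun do rewrite dotE.
    by apply: cvgD; exact: cvgM.
  have cfst : fst @ within (K `*` K) (nbhs (x, y)) --> within K (nbhs x).
    move=> A nA; exists ([set x' | K x' -> A x'], setT).
      by split => //; exact: filterT.
    by move=> [x' y'] /= [KA _] [Kx' _]; exact: KA.
  have csnd : snd @ within (K `*` K) (nbhs (x, y)) --> within K (nbhs y).
    move=> A nA; exists (setT, [set y' | K y' -> A y']).
      by split => //; exact: filterT.
    by move=> [x' y'] /= [_ KA] [_ Ky']; exact: KA.
  move/subspace_continuousP : cu => /(_ x Kx) cux.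
  move/subspace_continuousP : cv => /(_ y Ky) cvy.
  apply: cvgB; last first.
    by apply: cvgM; [exact: cvg_cst|exact: cvg_within_filter].
  by apply: cvgB; [exact: cvg_comp cfst cux|exact: cvg_comp csnd cvy].
have [[x y] /set_mem [/= Kx Ky] H] :=
  compact_EVT_max KK0 (compact_setX cK cK) cPhi.
exists x, y; split => // x' y' Kx' Ky'.
by apply: (H (x', y')); rewrite inE.
Qed.
End Compact.

(** * The comparison principle *)

Section Comparison.
Variable R : realType.
Implicit Types (Omega : set 'rV[R]_2) (u v : 'rV[R]_2 -> R).

(** At a maximum of the doubled functional, freezing either variable gives a
    test function for the other one; both have the same gradient because the
    penalty depends on [x - y] only. *)
Lemma doubling_viscosity Omega (H : 'rV[R]_2 -> R -> 'rV[R]_2 -> R) u v c x y :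
  viscosity_subsolution Omega H u -> viscosity_supersolution Omega H v ->
  Omega x -> Omega y ->
  (forall x' y', Omega x' -> Omega y' ->
    u x' - v y' - c * dot (x' - y') (x' - y') <=
    u x - v y - c * dot (x - y) (x - y)) ->
  H x (u x) ((2 * c) *: (x - y)) <= 0 <= H y (v y) ((2 * c) *: (x - y)).
Proof.
move=> [_ usub] [_ vsup] Ox Oy max_xy; apply/andP; split.
  rewrite -grad_sqdist; apply: usub => //; first exact: C1_on_sqdist.
  rewrite /local_max_on near_withinE; apply: nearW => z Oz.
  have := max_xy _ _ Oz Oy; lra.
have -> : (2 * c) *: (x - y) = grad (fun z => - c * dot (z - x) (z - x)) y.
  by rewrite grad_sqdist mulrN scaleNr -scalerN opprB.
apply: vsup => //; first exact: C1_on_sqdist.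
rewrite /local_min_on near_withinE; apply: nearW => z Oz.
have dotB (a b : 'rV[R]_2) : dot (a - b) (a - b) = dot (b - a) (b - a).
  by rewrite !dotE !mxE; ring.
have := max_xy _ _ Ox Oz; rewrite (dotB z) (dotB y); lra.
Qed.

(** The modulus hypothesis is used with [p] proportional to [x - y], so its
    right side is of the order of [|x - y| + c |x - y|^2], which is small at the
    maximum of the doubled functional. *)
Lemma comparison_principle Omega (H : 'rV[R]_2 -> R -> 'rV[R]_2 -> R) (C : R) :
  open Omega -> bounded_set Omega ->
  (forall B m, 0 < m -> exists2 gamma, 0 < gamma &
     forall x p r s, Omega x -> `|r| <= B -> `|s| <= B -> r + m <= s ->
       H x r p + gamma <= H x s p) ->
  0 <= C ->
  (forall x y r p, Omega x -> Omega y ->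
     H y r p - H x r p <= C * (enorm (x - y) * (1 + enorm p))) ->
  forall u v, {within closure Omega, continuous u} ->
    {within closure Omega, continuous v} ->
    viscosity_subsolution Omega H u -> viscosity_supersolution Omega H v ->
    (forall x, boundary Omega x -> u x <= v x) ->
    forall x, closure Omega x -> u x <= v x.
Proof.
move=> oO bO Hincr C0 Hx u v cu cv usub vsup ubv x0 Kx0.
have cK : compact (closure Omega).
  apply: bounded_closed_compact (@closed_closure _ _).
  exact: bounded_set_closure.
rewrite leNgt; apply/negP => vu0; pose m := u x0 - v x0.
have m0 : 0 < m by rewrite subr_gt0.
have [Bu Bu0 hBu] := compact_bounded cK cu.
have [Bv Bv0 hBv] := compact_bounded cK cv.
have [gamma gamma0 hgamma] := Hincr (Bu + Bv) m m0.
(* The final contradiction needs C * (|x - y| + 2 c |x - y|^2) < gamma, where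
   both |x - y| and c |x - y|^2 are less than e; the bound e <= m excludes
   maximizers on the boundary. *)
pose e := Num.min m (gamma / (3 * (C + 1))).
have e0 : 0 < e by rewrite lt_min m0 divr_gt0//; lra.
have em : e <= m by rewrite ge_min lexx.
have eg : 3 * C * e < gamma.
  have : e <= gamma / (3 * (C + 1)) by rewrite ge_min lexx orbT.
  rewrite ler_pdivlMr; last lra.
  move: e e0 {em} => e e0; nra.
clearbody e.
have [du du0 hdu] := compact_uniform_continuity cK cu e0.
have [dv dv0 hdv] := compact_uniform_continuity cK cv e0.
pose d := Num.min (Num.min du dv) e.
have d0 : 0 < d by rewrite lt_min e0 andbT lt_min du0.
have [ddu ddv de] : [/\ d <= du, d <= dv & d <= e].
  by rewrite /d; split; rewrite !ge_min !lexx ?orbT.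
(* The penalty is at most v x - v y <= 2 Bv, which forces |x - y| < d. *)
pose c := (2 * Bv + 1) / d ^+ 2.
have c0 : 0 < c by rewrite divr_gt0 ?exprn_gt0//; lra.
have [x [y [Kx Ky max_xy]]] := penalized_max c (ex_intro _ x0 Kx0) cK cu cv.
rewrite -sqr_enorm in max_xy.
set D := enorm (x - y) in max_xy.
have D0 : 0 <= D := enorm_ge0 _.
have dot0 z : dot (z - z) (z - z) = 0 :> R.
  by rewrite subrr dotE !mxE mul0r addr0.
have cD_v : c * D ^+ 2 <= v x - v y.
  have := max_xy _ _ Kx Kx; rewrite dot0; lra.
have m_uv : m <= u x - v y.
  have := max_xy _ _ Kx0 Kx0; rewrite dot0 -/m.
  have : 0 <= c * D ^+ 2 by rewrite mulr_ge0 ?sqr_ge0// ltW.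
  rewrite /m; lra.
have Dd : D < d.
  rewrite -(@ltr_pXn2r _ 2)// ?nnegrE ?ltW// -(ltr_pM2l c0).
  rewrite [X in _ < X]divfK ?gt_eqF ?exprn_gt0//.
  have := hBv x Kx; have := hBv y Ky; rewrite !ler_norml; lra.
have xyD : `|x - y| <= D := norm_le_enorm _.
have u_xy : `|u x - u y| < e by apply: hdu => //; lra.
have v_xy : `|v x - v y| < e by apply: hdv => //; lra.
rewrite ltr_norml in u_xy; rewrite ltr_norml in v_xy.
have insideP z : closure Omega z -> ~ boundary Omega z -> Omega z.
  move=> Kz; apply: contra_notP => nOz; split => //.
  by rewrite ((interior_id Omega).1 oO).
have Ox : Omega x by apply: insideP => // /ubv; lra.
have Oy : Omega y by apply: insideP => // /ubv; lra.
have sOK := @subset_closure _ Omega.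
pose p := (2 * c) *: (x - y).
have /andP[Hx0 Hy0] : H x (u x) p <= 0 <= H y (v y) p.
  apply: (doubling_viscosity usub vsup) => // x' y' /sOK Kx' /sOK Ky'.
  by rewrite -[dot (x - y) _]sqr_enorm; exact: max_xy.
have hg : H x (v y) p + gamma <= H x (u x) p.
  apply: hgamma => //; last lra.
    by rewrite (le_trans (hBv _ Ky))// lerDr.
  by rewrite (le_trans (hBu _ Kx))// lerDl.
have := Hx x y (v y) p Ox Oy; rewrite -/D.
have c20 : 0 <= 2 * c by rewrite mulr_ge0// ltW.
rewrite /p (enormZ _ c20) -/D.
have -> : D * (1 + 2 * c * D) = D + 2 * (c * D ^+ 2) by ring.
have : C * (D + 2 * (c * D ^+ 2)) <= C * (3 * e) by rewrite ler_wpM2l//; lra.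
rewrite -/p; lra.
Qed.

End Comparison.

(** * Uniqueness for the Dirichlet problem *)

Theorem corollary4p2 (R : realType) (Omega : set 'rV[R]_2) (f : R)
    (M : reflectance R) (I IA g : 'rV[R]_2 -> R)
    (Omega_open : open Omega) (Omega_bounded : bounded_set Omega)
    (f_gt0 : 0 < f) (M_admissible : admissible M)
    (I_lipschitz :
       [lipschitz (effective_intensity M I IA x) | x in closure Omega])
    (I_pos : exists (delta : R) (Gamma : set 'rV[R]_2),
       [/\ 0 < delta,
           forall x, boundary Omega x -> nbhs x Gamma
         & forall x, Gamma x -> closure Omega x ->
             delta <= effective_intensity M I IA x])
    (g_continuous : {within boundary Omega, continuous g}) :
  forall u v : 'rV[R]_2 -> R,
    dirichlet_viscosity_solution Omega (Hamiltonian M f I IA) g u ->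
    dirichlet_viscosity_solution Omega (Hamiltonian M f I IA) g v ->
    forall x, closure Omega x -> u x = v x.
Proof.
have [C C0 hC] : exists2 C : R, 0 <= C & forall x y r p, Omega x -> Omega y ->
    Hamiltonian M f I IA y r p - Hamiltonian M f I IA x r p <=
    C * (enorm (x - y) * (1 + enorm p)).
  apply: Hamiltonian_dist_le => //; first exact: reflectance_lipschitz.
  apply: sub_lipschitz I_lipschitz => A hA -[x y] [/= Ox Oy].
  by apply: hA; split; exact: subset_closure.
have le_of_boundary u v :
    dirichlet_viscosity_solution Omega (Hamiltonian M f I IA) g u ->
    dirichlet_viscosity_solution Omega (Hamiltonian M f I IA) g v ->
    forall x, closure Omega x -> u x <= v x.
  move=> [cu [usub _] ug] [cv [_ vsup] vg].
  apply: (comparison_principle Omega_open Omega_bounded _ C0 hC) => //.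
    move=> B m m0.
    have [gamma gamma0 hgamma] :=
      @Hamiltonian_strictly_increasing R f M I IA B m m0.
    by exists gamma => // x p r s _ _; exact: hgamma.
  by move=> x bx; rewrite ug// vg.
move=> u v hu hv x Kx; apply/eqP; rewrite eq_le.
by rewrite (le_of_boundary u v)// (le_of_boundary v u).
Qed.
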